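(* Let $P=(p^\mu_\nu)_{\mu,\nu=0}^3\in \mathrm{O}(1,3)$ and $Q=(q^\nu_\mu)=P^{-1}$. Define transformed objects ($\mu,\nu=0,1,2,3$, summation over repeated indices) by $$\widehat{x^\mu}=p^\mu_\nu x^\nu,\qquad \widehat\partial_\mu=q^\nu_\mu\partial_\nu,\qquad \widehat a_\mu=q^\nu_\mu a_\nu,\qquad \widehat{e^\mu}=p^\mu_\nu e^\nu,\qquad \widehat\Psi=\Psi,$$ and assume that $I=-e^1e^2$ and $E=e^0$ are invariant under the transformation (the same elements $I$ and $E$ appear in both equations below). If $\Psi:\mathbb{R}^{1,3}\to C\ell^{(0)}_{1,3}$ is a solution of the Dirac--Hestenes equation $$e^\mu\left(\partial_\mu\Psi+\Psi a_\mu I\right)E+m\Psi I=0,$$ then $\widehat\Psi$ is a solution of the transformed Dirac--Hestenes equation $$\widehat{e^\mu}\left(\widehat\partial_\mu\widehat\Psi+\widehat\Psi\,\widehat a_\mu I\right)E+m\widehat\Psi I=0.$$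
   Context: $C\ell_{1,3}$ is the real Clifford algebra with identity $e$ and generators $e^0,e^1,e^2,e^3$ satisfying $e^\mu e^\nu+e^\nu e^\mu=2\eta^{\mu\nu}e$, $\eta=\mathrm{diag}(1,-1,-1,-1)$. $C\ell^{(0)}_{1,3}$ is its even subalgebra, i.e. the span of products of an even number of generators. $\mathrm{O}(1,3)=\{A\in\mathrm{Mat}(4,\mathbb{R}) : A^\top\eta A=\eta\}$. In $p^\mu_\nu$ and $q^\nu_\mu$ the upper index is the row index and the lower one the column index, so $q^\alpha_\mu p^\mu_\nu=\delta^\alpha_\nu$. $\mathbb{R}^{1,3}$ is $\mathbb{R}^4$ with coordinates $x=(x^0,\dots,x^3)$ and metric $\eta$; $\partial_\mu=\partial/\partial x^\mu$; $m$ is a real constant (mass); $\mathbf a=(a_0,\dots,a_3):\mathbb{R}^{1,3}\to\mathbb{R}^4$ is a given vector-potential; $\Psi$ is differentiable. Untransformed functions are evaluated at $x$ and transformed (hatted) functions at $\widehat x$, so that $\widehat a_\mu(\widehat x)=q^\nu_\mu a_\nu(x)$ and $\widehat\Psi(\widehat x)=\Psi(x)$, where $\widehat x=Px$; $\widehat\partial_\mu=\partial/\partial\widehat{x^\mu}$. *)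

(* Defs.v *)
From HB Require Import structures.
From mathcomp Require Import all_boot all_order all_algebra.
From mathcomp Require Import all_classical all_reals all_analysis.
From mathcomp Require Import ring.

Set Implicit Arguments.
Unset Strict Implicit.
Unset Printing Implicit Defensive.

Import Order.TTheory GRing.Theory Num.Theory.
Import numFieldNormedType.Exports.

Local Open Scope ring_scope.

Definition eta (R : realType) : 'M[R]_4 :=
  \matrix_(mu, nu) (if mu == nu then if mu == 0 then 1 else -1 else 0).

Definition is_O13 (R : realType) (P : 'M[R]_4) : Prop :=
  P^T *m eta R *m P = eta R.

(* The algebra has the basis e_S, for S a set of indices, where e_S is the
   product of the generators e^i, i in S, in increasing order (cl_blade_prod).
   A vector is the row of its coordinates on this basis, so that the algebra
   carries the normed space structure of the row vectors. *)
Definition Cl13 (R : realType) : Type := 'rV[R]_#|{set 'I_4}|.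

HB.instance Definition _ (R : realType) :=
  NormedModule.on (Cl13 R).

Section Clifford.
Variable R : realType.
Implicit Types (x y z : Cl13 R) (S T U : {set 'I_4}).

Definition cl_coord x S : R := (x : 'rV[R]__) 0 (enum_rank S).

Definition cl_blade S : Cl13 R := delta_mx 0 (enum_rank S).

Definition symdiff S T : {set 'I_4} := [set i | (i \in S) (+) (i \in T)].

Definition cl_sign2 (i j : 'I_4) : R :=
  if (j < i)%N then -1 else if i == j then eta R i i else 1.

(* e_S e_T = cl_sign S T e_(S symdiff T): each factor e^j of e_T is moved to the
   left past the factors e^i of e_S with i > j, and each square e^i e^i that
   occurs is replaced by eta i i. *)
Definition cl_sign S T : R := \prod_(i in S) \prod_(j in T) cl_sign2 i j.

Definition cl_mul x y : Cl13 R :=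
  \sum_S \sum_T
    (cl_coord x S * cl_coord y T * cl_sign S T) *: cl_blade (symdiff S T).

Definition cl_one : Cl13 R := cl_blade finset.set0.

Lemma cl_coordE x : x = \sum_S cl_coord x S *: cl_blade S.
Proof.
rewrite /cl_coord /cl_blade [LHS](row_sum_delta (x : 'rV_#|{set 'I_4}|)).
rewrite (reindex (@enum_rank {set 'I_4})) //=.
by exists enum_val => S _; rewrite ?enum_rankK ?enum_valK.
Qed.

Lemma cl_coord_blade S T : cl_coord (cl_blade S) T = (S == T)%:R.
Proof.
by rewrite /cl_coord mxE eqxx /= (inj_eq enum_rank_inj) eq_sym.
Qed.

Lemma cl_coordD x y S : cl_coord (x + y) S = cl_coord x S + cl_coord y S.
Proof. by rewrite /cl_coord mxE. Qed.

Lemma cl_coordZ c x S : cl_coord (c *: x) S = c * cl_coord x S.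
Proof. by rewrite /cl_coord mxE. Qed.

Lemma cl_mulDl : left_distributive cl_mul +%R.
Proof.
move=> x y z; rewrite /cl_mul -big_split; apply: eq_bigr => S _ /=.
rewrite -big_split; apply: eq_bigr => T _ /=.
by rewrite cl_coordD !mulrDl scalerDl.
Qed.

Lemma cl_mulDr : right_distributive cl_mul +%R.
Proof.
move=> x y z; rewrite /cl_mul -big_split; apply: eq_bigr => S _ /=.
rewrite -big_split; apply: eq_bigr => T _ /=.
by rewrite cl_coordD mulrDr !mulrDl scalerDl.
Qed.

Lemma cl_scalerAl c x y : c *: cl_mul x y = cl_mul (c *: x) y.
Proof.
rewrite /cl_mul scaler_sumr; apply: eq_bigr => S _.
rewrite scaler_sumr; apply: eq_bigr => T _.
by rewrite cl_coordZ scalerA !mulrA.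
Qed.

Lemma cl_scalerAr c x y : c *: cl_mul x y = cl_mul x (c *: y).
Proof.
rewrite /cl_mul scaler_sumr; apply: eq_bigr => S _.
rewrite scaler_sumr; apply: eq_bigr => T _.
by rewrite cl_coordZ scalerA !mulrA [c * _]mulrC.
Qed.

Lemma cl_mul_suml (I : finType) (F : I -> Cl13 R) y :
  cl_mul (\sum_i F i) y = \sum_i cl_mul (F i) y.
Proof.
have y0 : cl_mul 0 y = 0 by have := cl_scalerAl 0 0 y; rewrite !scale0r.
exact: (big_morph (cl_mul^~ y) (fun u v => cl_mulDl u v y) y0).
Qed.

Lemma cl_mul_sumr (I : finType) (F : I -> Cl13 R) x :
  cl_mul x (\sum_i F i) = \sum_i cl_mul x (F i).
Proof.
have x0 : cl_mul x 0 = 0 by have := cl_scalerAr 0 x 0; rewrite !scale0r.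
exact: (big_morph (cl_mul x) (cl_mulDr x) x0).
Qed.

Lemma cl_mul_blade S T :
  cl_mul (cl_blade S) (cl_blade T) = cl_sign S T *: cl_blade (symdiff S T).
Proof.
rewrite /cl_mul (bigD1 S) //= [X in _ + X]big1 ?addr0 => [|S' /negPf nS].
  rewrite (bigD1 T) //= [X in _ + X]big1 ?addr0 => [|T' /negPf nT].
    by rewrite !cl_coord_blade !eqxx !mul1r.
  by rewrite !cl_coord_blade [T == _]eq_sym nT mulr0 mul0r scale0r.
apply: big1 => T' _.
by rewrite !cl_coord_blade [S == _]eq_sym nS !mul0r scale0r.
Qed.

Lemma cl_sign2K i j : cl_sign2 i j * cl_sign2 i j = 1.
Proof.
rewrite /cl_sign2 /eta mxE eqxx.
by do ?case: ifP => _; rewrite ?mulrNN mul1r.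
Qed.

Lemma prod_symdiff (f : 'I_4 -> R) S T : (forall i, f i * f i = 1) ->
  \prod_(i in symdiff S T) f i = (\prod_(i in S) f i) * (\prod_(i in T) f i).
Proof.
move=> fK; rewrite !(big_mkcond (fun i => i \in _)) -big_split /=.
apply: eq_bigr => i _; rewrite inE.
by case: (i \in S); case: (i \in T); rewrite ?fK ?mulr1 ?mul1r.
Qed.

Lemma cl_sign_symdiffl S T U :
  cl_sign (symdiff S T) U = cl_sign S U * cl_sign T U.
Proof.
apply: prod_symdiff => i; rewrite -big_split /=; apply: big1 => j _.
exact: cl_sign2K.
Qed.

Lemma cl_sign_symdiffr S T U :
  cl_sign S (symdiff T U) = cl_sign S T * cl_sign S U.
Proof.
rewrite /cl_sign -big_split /=; apply: eq_bigr => i _.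
by apply: prod_symdiff => j; exact: cl_sign2K.
Qed.

Lemma symdiffA S T U : symdiff S (symdiff T U) = symdiff (symdiff S T) U.
Proof. by apply/setP => i; rewrite !inE addbA. Qed.

Lemma symdiff0l S : symdiff finset.set0 S = S.
Proof. by apply/setP => i; rewrite !inE. Qed.

Lemma symdiff0r S : symdiff S finset.set0 = S.
Proof. by apply/setP => i; rewrite !inE addbF. Qed.

Lemma cl_mulA : associative cl_mul.
Proof.
move=> x y z; rewrite (cl_coordE x) (cl_coordE y) (cl_coordE z).
set X := \sum_S _; set Y := \sum_S _; set Z := \sum_S _.
rewrite {1}/X cl_mul_suml [cl_mul X Y]cl_mul_suml cl_mul_suml.
apply: eq_bigr => S _.
rewrite [cl_mul Y Z]cl_mul_suml cl_mul_sumr [cl_mul _ Y]cl_mul_sumr cl_mul_suml.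
apply: eq_bigr => T _.
rewrite [cl_mul _ Z]cl_mul_sumr cl_mul_sumr [RHS]cl_mul_sumr.
apply: eq_bigr => U _.
rewrite -!(cl_scalerAl, cl_scalerAr) !cl_mul_blade.
rewrite -!(cl_scalerAl, cl_scalerAr) !cl_mul_blade symdiffA.
rewrite cl_sign_symdiffl cl_sign_symdiffr !scalerA.
by congr (_ *: _); ring.
Qed.

Lemma cl_mul1l : left_id cl_one cl_mul.
Proof.
move=> x; rewrite {1}(cl_coordE x) cl_mul_sumr [RHS]cl_coordE.
apply: eq_bigr => S _; rewrite -cl_scalerAr cl_mul_blade symdiff0l.
by rewrite /cl_sign big_set0 scale1r.
Qed.

Lemma cl_mul1r : right_id cl_one cl_mul.
Proof.
move=> x; rewrite {1}(cl_coordE x) cl_mul_suml [RHS]cl_coordE.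
apply: eq_bigr => S _; rewrite -cl_scalerAl cl_mul_blade symdiff0r.
rewrite /cl_sign big1 ?scale1r // => i _; exact: big_set0.
Qed.

Lemma cl_one_neq0 : cl_one != 0.
Proof.
apply/eqP => /(congr1 (fun x => cl_coord x finset.set0)).
by rewrite cl_coord_blade eqxx /cl_coord mxE => /eqP; rewrite oner_eq0.
Qed.

HB.instance Definition _ := GRing.Zmodule_isNzRing.Build (Cl13 R)
  cl_mulA cl_mul1l cl_mul1r cl_mulDl cl_mulDr cl_one_neq0.
HB.instance Definition _ :=
  GRing.Lmodule_isLalgebra.Build R (Cl13 R) cl_scalerAl.
HB.instance Definition _ :=
  GRing.Lalgebra_isAlgebra.Build R (Cl13 R) cl_scalerAr.

Definition cl_gen (mu : 'I_4) : Cl13 R := cl_blade (finset.set1 mu).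

Lemma cl_gen_rel mu nu :
  cl_gen mu * cl_gen nu + cl_gen nu * cl_gen mu = (2 * eta R mu nu)%:A.
Proof.
have E i j : cl_gen i * cl_gen j =
    cl_sign2 i j *: cl_blade (symdiff (finset.set1 i) (finset.set1 j)).
  by rewrite [LHS]cl_mul_blade /cl_sign !big_set1.
rewrite !E.
have -> : symdiff (finset.set1 nu) (finset.set1 mu)
        = symdiff (finset.set1 mu) (finset.set1 nu).
  by apply/setP => i; rewrite !inE addbC.
rewrite -scalerDl /cl_sign2; have [<-|ne] := eqVneq mu nu.
  rewrite ltnn -mulr2n mulr_natl; congr (_ *: cl_blade _).
  by apply/setP => i; rewrite !inE addbb.
rewrite [eta R mu nu]mxE (negPf ne) mulr0 scale0r.
have : (mu : nat) != nu by [].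
by rewrite neq_ltn => /orP[] lt; rewrite lt ltnNge (ltnW lt) /=
  ?(subrr, addNr) scale0r.
Qed.

Lemma cl_blade_prod S : cl_blade S = \prod_(mu <- enum S) cl_gen mu.
Proof.
suff H (s : seq 'I_4) : sorted ltn (map val s) ->
    cl_blade (finset.finset (mem s)) = \prod_(mu <- s) cl_gen mu.
  rewrite -H; last first.
    rewrite /enum_mem -enumT; apply: (subseq_sorted ltn_trans) (_ : sorted _ (iota 0 4)).
      by rewrite -val_enum_ord; apply/map_subseq/filter_subseq.
    exact: iota_ltn_sorted.
  by congr cl_blade; apply/setP => i; rewrite [RHS]inE -[LHS]mem_enum.
elim: s => [_|i s IH /= ss].
  by rewrite big_nil; congr cl_blade; apply/setP => i; rewrite !inE.
rewrite big_cons -IH ?(path_sorted ss)//.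
have lts j : j \in s -> (i < j)%N.
  move=> js; have /allP := order_path_min ltn_trans ss.
  by apply; apply/map_f.
have nis : i \notin s by apply/negP => /lts; rewrite ltnn.
rewrite [RHS]cl_mul_blade /cl_sign big_set1 big1 => [|j]; last first.
  rewrite inE => /lts ij; rewrite /cl_sign2 ltnNge (ltnW ij) /=.
  by case: eqP ij => // ->; rewrite ltnn.
rewrite scale1r; congr cl_blade; apply/setP => j; rewrite !inE.
by case: eqP => // ->; rewrite (negPf nis).
Qed.

Definition cl_even (x : Cl13 R) : Prop :=
  exists s : seq (R * seq 'I_4), all (fun w => ~~ odd (size w.2)) s /\
    x = \sum_(w <- s) w.1 *: \prod_(mu <- w.2) cl_gen mu.

Definition cl_I : Cl13 R := - (cl_gen 1 * cl_gen 2).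
Definition cl_E : Cl13 R := cl_gen 0.

Local Notation V := 'cV[R]_4.

Definition partial (mu : 'I_4) (F : V -> Cl13 R) (x : V) : Cl13 R :=
  'D_(delta_mx mu 0) F x.

(* The generators are a parameter (cl_gen, or the transformed ones), whereas
   cl_even, cl_I and cl_E always refer to cl_gen. *)
Definition DH_solution (m : R) (g : 'I_4 -> Cl13 R) (a : V -> 'rV[R]_4)
    (Psi : V -> Cl13 R) : Prop :=
  [/\ forall x : V, cl_even (Psi x),
      forall x : V, differentiable Psi x &
      forall x : V,
        (\sum_mu g mu * (partial mu Psi x + Psi x * (a x 0 mu *: cl_I))) * cl_E
          + m *: (Psi x * cl_I) = 0].

Variable P : 'M[R]_4.
Let Q := invmx P.

Definition hat_gen (mu : 'I_4) : Cl13 R := \sum_nu P mu nu *: cl_gen nu.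

Definition hat_pot (a : V -> 'rV[R]_4) (xhat : V) : 'rV[R]_4 :=
  \row_mu \sum_nu Q nu mu * a (Q *m xhat) 0 nu.

Definition hat_fun (Psi : V -> Cl13 R) (xhat : V) : Cl13 R := Psi (Q *m xhat).

End Clifford.

(* Main.v *)
(* By the chain rule the partial derivatives transform covariantly, with the
   matrix Q, as does the potential, whereas the generators transform
   contravariantly, with the matrix P. Since Q P = 1, the contraction of the
   generators with the covariant derivative of Psi is unchanged, so the
   transformed equation at y is the original one at Q y. *)
Require Import Defs.
From mathcomp Require Import all_boot all_order all_algebra.
From mathcomp Require Import all_classical all_reals all_analysis.

Import GRing.Theory.
Import numFieldNormedType.Exports.

Local Open Scope ring_scope.

(** Since [eta R] squares to the identity, [eta R *m P^T *m eta R] is a left inverse of [P]. *)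
Lemma is_O13_unitmx (R : realType) (P : 'M[R]_4) : is_O13 P -> P \in unitmx.
Proof.
move=> hP.
have eta2 : eta R *m eta R = 1%:M.
  apply/matrixP => i j; rewrite mxE (bigD1 i) //= big1 => [|k /negPf ki].
    rewrite !mxE eqxx addr0; case: (i == j); rewrite ?mulr0 //.
    by case: ifP => _; rewrite ?mulr1 ?mulrNN ?mulr1.
  by rewrite !mxE eq_sym ki mul0r.
have : (eta R *m P^T *m eta R) *m P = 1%:M.
  by rewrite -!mulmxA [P^T *m _]mulmxA hP eta2.
by case/mulmx1_unit.
Qed.

(** Needed for differentiability of a linear map; the product combines the fixed columns of [A] with
    continuous coefficients. *)
Lemma mulmx_continuous (R : realType) (k n : nat) (A : 'M[R]_(k, n)) :
  continuous (mulmx A : 'cV[R]_n -> 'cV[R]_k).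
Proof.
have -> : mulmx A = fun x : 'cV[R]_n => \sum_j x j 0 *: col j A.
  apply/funext => x; apply/matrixP => i l; rewrite summxE mxE.
  by apply: eq_bigr => j _; rewrite !mxE (ord1 l) mulrC.
apply: continuous_big => [|j _ x]; first exact: add_continuous.
by apply: cvgZr_tmp; [exact: nbhs_filter|exact: coord_continuous].
Qed.

Section LinearSubstitution.
Variables (R : realType) (W : normedModType R) (n : nat).
Variables (A : 'M[R]_n) (F : 'cV[R]_n -> W) (x : 'cV[R]_n).
Hypothesis dF : differentiable F (A *m x).

Lemma differentiable_comp_mulmx :
  differentiable (fun y : 'cV[R]_n => F (A *m y)) x.
Proof.
apply: (@differentiable_comp _ _ _ _ (mulmx A) F) => //.
exact/linear_differentiable/mulmx_continuous.
Qed.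

(** Chain rule: a continuous linear map is its own differential. *)
Lemma derive_comp_mulmx (v : 'cV[R]_n) :
  'D_v (fun y : 'cV[R]_n => F (A *m y)) x = 'D_(A *m v) F (A *m x).
Proof.
have cA := @mulmx_continuous R n n A.
have dA : differentiable (mulmx A : 'cV[R]_n -> 'cV[R]_n) x.
  exact/linear_differentiable.
rewrite !deriveE //; last exact: differentiable_comp_mulmx.
have dAv := congr1 (fun g => g v) (@diff_lin _ _ _ (mulmx A) x cA).
rewrite -[A *m v]dAv.
have dFAv := congr1 (fun g => g v) (@diff_comp _ _ _ _ (mulmx A) F x dA dF).
exact: dFAv.
Qed.

End LinearSubstitution.

Lemma derive_sum_delta (R : realType) (W : normedModType R) (n : nat)
    (F : 'cV[R]_n -> W) (x v : 'cV[R]_n) : differentiable F x ->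
  'D_v F x = \sum_i v i 0 *: 'D_(delta_mx i 0) F x.
Proof.
move=> dF; rewrite deriveE // {1}(matrix_sum_delta v) linear_sum.
by apply: eq_bigr => i _; rewrite big_ord1 linearZ deriveE.
Qed.

Lemma partial_hat_fun (R : realType) (P : 'M[R]_4) (Psi : 'cV[R]_4 -> Cl13 R)
    (mu : 'I_4) (y : 'cV[R]_4) :
  differentiable Psi (invmx P *m y) ->
  partial mu (hat_fun P Psi) y =
  \sum_nu invmx P nu mu *: partial nu Psi (invmx P *m y).
Proof.
move=> dPsi; rewrite /partial /hat_fun derive_comp_mulmx // derive_sum_delta //.
(* The direction [invmx P *m delta_mx mu 0] is column [mu] of [invmx P]. *)
by apply: eq_bigr => nu _; rewrite -colE mxE.
Qed.

(** Scalars are central, so summing over [mu] first collects the coefficients into entries of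
    [Q *m P]. *)
Lemma sum_contravariant_covariant (R : comNzRingType) (A : algType R) (n : nat)
    (P Q : 'M[R]_n) (e X : 'I_n -> A) : Q *m P = 1%:M ->
  \sum_mu (\sum_nu P mu nu *: e nu) * (\sum_nu Q nu mu *: X nu) =
  \sum_nu e nu * X nu.
Proof.
move=> QP.
transitivity (\sum_nu \sum_k (Q *m P) k nu *: (e nu * X k)).
  under eq_bigr => mu _ do rewrite mulr_suml.
  rewrite exchange_big; apply: eq_bigr => nu _.
  under eq_bigr => mu _ do rewrite mulr_sumr.
  rewrite exchange_big; apply: eq_bigr => k _.
  rewrite mxE scaler_suml; apply: eq_bigr => mu _.
  by rewrite -scalerAl -scalerAr scalerA mulrC.
apply: eq_bigr => nu _; rewrite QP (bigD1 nu) //= mxE eqxx scale1r.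
by rewrite big1 ?addr0 // => k /negPf kn; rewrite mxE kn scale0r.
Qed.

(* The first conclusion is the rule for the transformed partial derivatives;
   in the second one they are the partial derivatives with respect to the
   transformed coordinates. *)
Theorem theorem3p2 (R : realType) (m : R) (P : 'M[R]_4)
    (a : 'cV[R]_4 -> 'rV[R]_4) (Psi : 'cV[R]_4 -> Cl13 R) :
  is_O13 P ->
  DH_solution m (@cl_gen R) a Psi ->
  (forall (mu : 'I_4) (x : 'cV[R]_4),
     partial mu (hat_fun P Psi) (P *m x) =
     \sum_nu invmx P nu mu *: partial nu Psi x) /\
  DH_solution m (hat_gen P) (hat_pot P a) (hat_fun P Psi).
Proof.
move=> /is_O13_unitmx Pu [Psi_even dPsi DH]; split=> [mu x|].
  by rewrite partial_hat_fun ?mulKmx.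
split=> [y|y|y]; first exact: Psi_even.
  exact: differentiable_comp_mulmx.
(* The zero becomes the left side of the original equation at [invmx P *m y]; the mass terms then
   agree by conversion. *)
rewrite -[RHS](DH (invmx P *m y)).
rewrite -(@sum_contravariant_covariant _ _ _ P (invmx P) (@cl_gen R)) ?mulVmx //.
congr (GRing.add (GRing.mul _ _) _).
apply: eq_bigr => mu _; congr (_ * _).
rewrite partial_hat_fun // mxE scaler_suml mulr_sumr -big_split.
apply: eq_bigr => nu _ /=.
by rewrite scalerDr -scalerA -scalerAr.
Qed.
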